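(* (A Christoffel formula.) Let $\mu$ be a complex Borel measure on $\mathbb{T}^D$ and $L$ a Laurent polynomial of longitude $m=\ell(L)$ such that both $\mu$ and the perturbed measure $T\,d\mu=L\,d\mu$ are quasi-definite. Let $\mathcal N_{k,m}=\{p_1,\dots,p_{r_{k,m}}\}\subset Z(L)$ be a poised set of nodes. Then the Laurent polynomials $T\phi_{[k]}$ associated with $L\,d\mu$ are given in terms of those of $\mu$ by $$T\phi_{[k]}(z)=\frac{(L(\Upsilon))_{[k],[k+m]}}{L(z)}\;\Theta_*\left(\begin{array}{c|c}\Sigma_k^m&\begin{matrix}\phi_{[k]}(z)\\ \vdots\\ \phi_{[k+m-1]}(z)\end{matrix}\\ \hline \Sigma_{[k,m]}&\phi_{[k+m]}(z)\end{array}\right).$$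
   Context: Let $D\ge1$, $z(\theta)=(e^{i\theta_1},\dots,e^{i\theta_D})$. For $\alpha\in\mathbb{Z}^D$ put $|\alpha|=\sum_a|\alpha_a|$, $z^\alpha=\prod_a z_a^{\alpha_a}$, $[k]=\{\alpha:|\alpha|=k\}$ with cardinality $|[k]|$. Multi-indices are ordered by $|\alpha|$ and lexicographically inside each $[k]$; $\chi(z)$ is the semi-infinite column of all monomials in this order. Semi-infinite matrices have the corresponding block structure $A_{[k],[l]}$; $A^{[k]}$ denotes truncation to blocks $0,\dots,k-1$. The moment matrix is $G=\oint_{\mathbb{T}^D}\chi(z(\theta))d\mu(\theta)\chi(z(\theta))^\dagger$; $\mu$ is quasi-definite if $\det G^{[k]}\ne0$ for all $k\ge1$, and then uniquely $G=S^{-1}H(\hat S^{-1})^\dagger$ with $S,\hat S$ block lower unitriangular, $H$ block diagonal. $\Phi=S\chi$ has blocks $\phi_{[k]}$. A prefix $T$ denotes the corresponding object for the measure $L(z(\theta))d\mu(\theta)$. For a Laurent polynomial $L=\sum_\alpha L_\alpha z^\alpha$, the longitude is $\ell(L)=\max\{|\alpha|:L_\alpha\ne0\}$, $Z(L)=\{p\in(\mathbb{C}^* )^D:L(p)=0\}$, and $L(\Upsilon)$ is the semi-infinite matrix with entries $(L(\Upsilon))_{\beta,\gamma}=L_{\gamma-\beta}$. Let $r_{k,m}=|[k]|+\cdots+|[k+m-1]|$. For nodes $p_1,\dots,p_{r_{k,m}}$ the sample matrices are the square matrix $\Sigma_k^m$ of size $r_{k,m}$ whose $j$-th column is $(\phi_{[k]}(p_j);\dots;\phi_{[k+m-1]}(p_j))$,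 and $\Sigma_{[k,m]}=(\phi_{[k+m]}(p_1),\dots,\phi_{[k+m]}(p_{r_{k,m}}))$. The set of nodes is poised if it is contained in $Z(L)$ and $\det\Sigma_k^m\ne0$. The last quasi-determinant is $\Theta_*\begin{pmatrix}A&B\\C&E\end{pmatrix}=E-CA^{-1}B$. The identity is for $z\in(\mathbb{C}^* )^D$ with $L(z)\neq0$. *)

(* Defs.v *)
From HB Require Import structures.
From mathcomp Require Import all_boot all_order all_algebra finmap.
From mathcomp Require Import all_classical all_reals all_analysis.
From mathcomp Require Import zify.
From mathcomp Require Export complex.

Set Implicit Arguments.
Unset Strict Implicit.
Unset Printing Implicit Defensive.

Import Order.TTheory GRing.Theory Num.Theory.
Import numFieldNormedType.Exports.

Local Open Scope classical_set_scope.
Local Open Scope ring_scope.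

Section ComplexMeasure.
Context d (T : measurableType d) (R : realType).
Implicit Types (nu : {charge set T -> \bar R}) (D : set T).

Definition hahn_sets nu : {PN : set T * set T | hahn_decomposition nu PN.1 PN.2}.
Proof.
by apply: cid; have [P [N PN]] := Hahn_decomposition nu; exists (P, N).
Defined.

(* Integral against nu = nu+ - nu-; Hahn decompositions are unique up to
   nu-null sets, so the chosen one does not matter. *)
Definition charge_integral nu D (f : T -> R) : R :=
  \int[jordan_pos (svalP (hahn_sets nu))]_(x in D) f x
  - \int[jordan_neg (svalP (hahn_sets nu))]_(x in D) f x.

(* A complex measure is given by its real and imaginary parts; charges in the
   library are finite signed measures. *)
Record complex_measure := ComplexMeasure {
  cmeas_Re : {charge set T -> \bar R};
  cmeas_Im : {charge set T -> \bar R} }.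

Definition cmeas (mu : complex_measure) (A : set T) : R[i] :=
  (fine (cmeas_Re mu A) +i* fine (cmeas_Im mu A))%C.

Definition cintegral (mu : complex_measure) D (f : T -> R[i]) : R[i] :=
  let u x := complex.Re (f x) in
  let v x := complex.Im (f x) in
  ((charge_integral (cmeas_Re mu) D u - charge_integral (cmeas_Im mu) D v)
   +i* (charge_integral (cmeas_Im mu) D u + charge_integral (cmeas_Re mu) D v))%C.

Definition has_density (nu : complex_measure) (f : T -> R[i])
    (mu : complex_measure) : Prop :=
  forall A, measurable A -> cmeas nu A = cintegral mu A f.

End ComplexMeasure.

Section Torus.
Variables (R : realType) (D : nat).

Definition torus_set : set 'rV[(R[i])^o]_D := [set z | forall a, `|z 0 a| = 1].

(* [set_type] carries the topology induced by the ambient C^D. The points are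
   the z(theta) themselves, not the angles theta. *)
Definition torus := set_type torus_set.

HB.instance Definition _ := Topological.on torus.

Lemma torus_set1 : (const_mx 1 : 'rV[(R[i])^o]_D) \in torus_set.
Proof. by apply/mem_set => a; rewrite mxE normr1. Qed.

HB.instance Definition _ := isPointed.Build torus
  (exist (fun z => z \in torus_set) _ torus_set1).

Definition borel_torus := g_sigma_algebraType (@open torus).

HB.instance Definition _ := Measurable.on borel_torus.

Definition torus_pt (t : borel_torus) : 'rV[R[i]]_D := \val (t : torus).

End Torus.

Notation mindex D := {ffun 'I_D -> int}.

Section MultiIndex.
Variable D : nat.
Implicit Types (al be : mindex D) (k : nat).

Definition mlen al : nat := \sum_a `|al a|%N.

Definition mlexi : rel (mindex D) :=
  fun al be => ([seq al a | a <- enum 'I_D] <= [seq be a | a <- enum 'I_D]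
                  :> seqlexi int)%O.

(* The candidates are the multi-indices with all entries in [-k, k]. *)
Definition level k : seq (mindex D) :=
  sort mlexi [seq al <- [seq [ffun a => (f a)%:Z - k%:Z]
                          | f : {ffun 'I_D -> 'I_(2 * k).+1}] | mlen al == k].

Lemma mem_level k al : (al \in level k) = (mlen al == k).
Proof.
rewrite mem_sort mem_filter; case: eqP => //= <-.
have bd a : (`|al a| <= mlen al)%N by rewrite /mlen (bigD1 a)//= leq_addr.
have lt0 a : (`|(al a + (mlen al)%:Z)%R|%N < (2 * mlen al).+1)%N.
  by have := bd a; lia.
apply/mapP; exists [ffun a => Ordinal (lt0 a)]; first exact: mem_enum.
by apply/ffunP => a; rewrite !ffunE /=; have := bd a; lia.
Qed.

Lemma level_uniq k : uniq (level k).
Proof.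
rewrite sort_uniq filter_uniq// map_inj_uniq ?enum_uniq// => f g /ffunP fg.
apply/ffunP => a; apply/val_inj; have := fg a; rewrite !ffunE => /addIr.
by case.
Qed.

Lemma level_sorted k : sorted mlexi (level k).
Proof. by apply: sort_sorted => al be; exact: le_total. Qed.

Definition lsize k : nat := size (level k).

Definition midx k (i : 'I_(lsize k)) : mindex D := nth 0 (level k) i.

End MultiIndex.

Arguments lsize : clear implicits.

Notation laurent R D := {fsfun mindex D -> R[i] with 0}.

Section Laurent.
Variables (R : realType) (D : nat).
Local Notation C := R[i].
Implicit Types (L : laurent R D) (z : 'rV[C]_D) (al : mindex D).

Definition cstar z : Prop := forall a, z 0 a != 0.

Definition mono al z : C := \prod_a z 0 a ^ al a.

Definition leval L z : C := \sum_(al <- finsupp L) L al * mono al z.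

Definition longitude L : nat := \max_(al <- finsupp L) mlen al.

Definition zero_locus L : set 'rV[C]_D := [set p | cstar p /\ leval L p = 0].

End Laurent.

Section SemiInfinite.
Variables (R : realType) (D : nat).
Local Notation C := R[i].
Local Notation n := (lsize D).

Definition simx := forall k l : nat, 'M[C]_(n k, n l).

Definition simx_of (a : mindex D -> mindex D -> C) : simx :=
  fun k l => \matrix_(i, j) a (midx i) (midx j).

Definition trunc (A : simx) k : 'M[C]_(\sum_(i < k) n i) :=
  \mxblock_(i < k, j < k) A i j.

Definition sione : simx := simx_of (fun al be => (al == be)%:R).

(* The product of a block lower triangular matrix with an arbitrary one: block
   row k of A vanishes past column k, which makes the sum finite. *)
Definition simul (A B : simx) : simx :=
  fun k l => \sum_(j < k.+1) A k j *m B j l.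

Definition sidagger (A : simx) : simx := fun k l => map_mx Num.conj (A l k)^T.

Definition lower_unitri (A : simx) : Prop :=
  (forall k l, (k < l)%N -> A k l = 0) /\ (forall k, A k k = 1%:M).

Definition block_diag (A : simx) : Prop := forall k l, k != l -> A k l = 0.

Definition lower_inverse (A Ai : simx) : Prop :=
  [/\ lower_unitri Ai,
      forall k l, simul A Ai k l = sione k l &
      forall k l, simul Ai A k l = sione k l].

(* G = S^-1 H (Sh^-1)^dagger, with Si and Shi the (unique) lower triangular
   inverses of S and Sh; the left factors of both products are lower
   triangular, as [simul] requires. *)
Definition gauss_borel (G S H Sh : simx) : Prop :=
  [/\ lower_unitri S, lower_unitri Sh, block_diag H &
      exists Si Shi, [/\ lower_inverse S Si, lower_inverse Sh Shi &
        forall k l, G k l = simul Si (simul H (sidagger Shi)) k l]].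

Definition moment_matrix (mu : complex_measure (borel_torus R D) R) : simx :=
  simx_of (fun al be => cintegral mu [set: borel_torus R D]
    (fun t => mono al (torus_pt t) * (mono be (torus_pt t))^*)).

Definition quasi_definite (mu : complex_measure (borel_torus R D) R) : Prop :=
  forall k, (1 <= k)%N -> \det (trunc (moment_matrix mu) k) != 0.

Definition upsilon (L : laurent R D) : simx :=
  simx_of (fun be ga => L (ga - be)).

Definition chi k (z : 'rV[C]_D) : 'cV[C]_(n k) := \col_i mono (midx i) z.

(* The k-th block of Phi = S chi, for S block lower triangular. *)
Definition phi (S : simx) k (z : 'rV[C]_D) : 'cV[C]_(n k) :=
  \sum_(l < k.+1) S k l *m chi l z.

Definition nnodes k m : nat := \sum_(i < m) n (k + i).

Definition phi_stack (S : simx) k m (z : 'rV[C]_D) : 'cV[C]_(nnodes k m) :=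
  \mxcol_(i < m) phi S (k + i) z.

Definition sample_mx (S : simx) k m (p : 'I_(nnodes k m) -> 'rV[C]_D) :
    'M[C]_(nnodes k m) :=
  \matrix_(i, j) phi_stack S k m (p j) i 0.

Definition sample_row (S : simx) k m (p : 'I_(nnodes k m) -> 'rV[C]_D) :
    'M[C]_(n (k + m), nnodes k m) :=
  \matrix_(i, j) phi S (k + m) (p j) i 0.

Definition poised (L : laurent R D) (S : simx) k m
    (p : 'I_(nnodes k m) -> 'rV[C]_D) : Prop :=
  (forall j, zero_locus L (p j)) /\ \det (sample_mx S p) != 0.

End SemiInfinite.

Definition last_quasidet (F : fieldType) (r s q : nat) (A : 'M[F]_r)
    (B : 'M[F]_(r, s)) (C : 'M[F]_(q, r)) (E : 'M[F]_(q, s)) : 'M[F]_(q, s) :=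
  E - C *m invmx A *m B.

(* Main.v *)
(* Write [G = S^-1 X] with [X = H (Sh^-1)^dagger] block upper triangular, and
   [TG = TS^-1 TX] likewise. Since [L dmu] has moment matrix [L(Upsilon) G],
   the resolvent [w = TS L(Upsilon) S^-1] satisfies [w X = TX], so it is block
   upper triangular (the diagonal blocks of [X] are invertible because the
   truncations of [G] are); by its first expression it has no block beyond the
   m-th superdiagonal, where it equals [L(Upsilon)]. As
   [w Phi (z) = L(z) TPhi (z)], row [k] expresses [L(z) Tphi_k(z)] through
   [phi_k(z), ..., phi_(k+m)(z)]; evaluating at the nodes, where [L] vanishes,
   determines the coefficients other than the last.

   The moments of a measure with a density are computed by uniform
   approximation of bounded measurable functions by step functions. *)

Require Import Defs.
From mathcomp Require Import all_boot all_order all_algebra finmap.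
From mathcomp Require Import all_classical all_reals all_analysis.
From mathcomp Require Import measurable_realfun ring lra zify.

Set Implicit Arguments.
Unset Strict Implicit.
Unset Printing Implicit Defensive.

Import Order.TTheory GRing.Theory Num.Theory.
Import numFieldNormedType.Exports.

Local Open Scope classical_set_scope.
Local Open Scope ring_scope.

(** * Integrals of bounded measurable functions against a charge *)

Section BoundedMeasurable.
Context d (T : measurableType d) (R : realType).
Implicit Types (f g : T -> R) (A : set T) (c : R).

(** Closed under sums and products, and integrable against every finite measure, so linearity of the
    integral requires no separate integrability conditions. *)
Definition bmeas f := measurable_fun setT f /\ exists M, forall x, `|f x| <= M.

Lemma bmeas_cst c : bmeas (fun=> c).
Proof. by split; [exact: measurable_cst|exists `|c|]. Qed.

Lemma bmeasD f g : bmeas f -> bmeas g -> bmeas (fun x => f x + g x).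
Proof.
move=> [mf [M fM]] [mg [N gN]]; split; first exact: measurable_funD.
by exists (M + N) => x; rewrite (le_trans (ler_normD _ _))// lerD.
Qed.

Lemma bmeasM f g : bmeas f -> bmeas g -> bmeas (fun x => f x * g x).
Proof.
move=> [mf [M fM]] [mg [N gN]]; split; first exact: measurable_funM.
by exists (M * N) => x; rewrite normrM ler_pM.
Qed.

Lemma bmeasZ c f : bmeas f -> bmeas (fun x => c * f x).
Proof. exact/bmeasM/bmeas_cst. Qed.

Lemma bmeasB f g : bmeas f -> bmeas g -> bmeas (fun x => f x - g x).
Proof.
move=> bf /(bmeasZ (-1)) /(bmeasD bf).
by under eq_fun do rewrite mulN1r.
Qed.

Lemma bmeas_sum n (F : 'I_n -> T -> R) :
  (forall i, bmeas (F i)) -> bmeas (fun x => \sum_i F i x).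
Proof.
elim: n F => [|n IH] F bF.
  by under eq_fun do rewrite big_ord0; exact: bmeas_cst.
by under eq_fun do rewrite big_ord_recr /=; apply: bmeasD => //; exact: IH.
Qed.

Lemma bmeas_indic A : measurable A -> bmeas (\1_A).
Proof.
move=> mA; split; first exact: measurable_indic.
by exists 1 => x; rewrite indicE; case: (_ \in _); rewrite ?normr1 ?normr0.
Qed.

Lemma bmeas_integrable (mu : {finite_measure set T -> \bar R}) f :
  bmeas f -> mu.-integrable setT (EFin \o f).
Proof.
move=> [mf [M fM]]; apply: measurable_bounded_integrable => //.
  by rewrite fin_num_fun_lty//; exact: fin_num_measure.
exists M; split; first exact: num_real.
by move=> y My x _; apply: le_trans (fM x) _; exact: ltW.
Qed.

(* The layer sum is e * floor (y / e). *)
Lemma layer_approx (e y : R) (N : nat) : 0 < e -> 0 <= y <= N%:R * e ->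
  `|y - \sum_(i < N) e * ((i.+1%:R * e <= y)%R : nat)%:R| <= e.
Proof.
move=> e0; elim: N y => [|N IH] y /andP[y0 yN].
  by rewrite big_ord0 ger0_norm; lra.
have [yNe|yNe] := leP y (N%:R * e).
  rewrite big_ord_recr/=.
  case: (leP (N.+1%:R * e) y) => h; last by rewrite mulr0 addr0 IH ?y0.
  by move: h; rewrite -natr1; lra.
(* Here [y > N * e], so the first [N] layers are full and only the top one is in doubt. *)
rewrite (eq_bigr (fun i : 'I_N.+1 =>
    e * ((i != ord_max :> 'I_N.+1) || (N.+1%:R * e <= y)%R)%:R)); last first.
  move=> i _; congr (_ * (nat_of_bool _)%:R).
  case: eqP => [->//|/eqP iN] /=.
  apply: le_trans (ltW yNe); rewrite ler_pM2r// ler_nat.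
  by have := ltn_ord i; move: iN; rewrite -val_eqE /=; lia.
rewrite big_ord_recr/= eqxx/= (eq_bigr (fun=> e)) => [|i _]; last first.
  by rewrite -val_eqE/= neq_ltn ltn_ord mulr1.
rewrite sumr_const card_ord -mulr_natl.
move: yN; case: (leP (N.+1%:R * e) y); rewrite -natr1 => h yN;
  rewrite ?mulr1 ?mulr0 ler_norml; apply/andP; split; move: h yN; lra.
Qed.

(** The layer sum written with indicators of superlevel sets, whose integrals are known. *)
Definition step_fun f e N := fun x =>
  \sum_(i < N) e * \1_[set t | i.+1%:R * e <= f t] x.

Lemma step_fun_approx f : bmeas f -> (forall x, 0 <= f x) -> forall e, 0 < e ->
  exists N, forall x, `|f x - step_fun f e N x| <= e.
Proof.
move=> [mf [M fM]] f0 e e0.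
(* The layers, each of height [e], have to reach above the bound [M]. *)
exists (Num.truncn (M / e)).+1 => x; rewrite /step_fun.
rewrite (eq_bigr (fun i : 'I__ => e * ((i.+1%:R * e <= f x)%R : nat)%:R));
  last first.
  move=> i _; rewrite indicE; congr (_ * (nat_of_bool _)%:R).
  by apply/idP/idP; rewrite inE.
apply: layer_approx => //; rewrite f0/=.
have := fM x; rewrite ger0_norm// => /le_trans; apply.
by rewrite -ler_pdivrMr// ltW// truncnS_gt.
Qed.

Section ChargeIntegral.
Variable nu : {charge set T -> \bar R}.
Local Notation I := (charge_integral nu setT).

Lemma charge_integralD f g : bmeas f -> bmeas g ->
  I (fun x => f x + g x) = I f + I g.
Proof.
move=> bf bg; rewrite /charge_integral.
rewrite !RintegralD//; try exact: bmeas_integrable.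
by rewrite addrACA opprD.
Qed.

Lemma charge_integralZ c f : bmeas f -> I (fun x => c * f x) = c * I f.
Proof.
move=> bf; rewrite /charge_integral.
by rewrite !RintegralZl//; [rewrite mulrBr|exact: bmeas_integrable..].
Qed.

Lemma charge_integralB f g : bmeas f -> bmeas g ->
  I (fun x => f x - g x) = I f - I g.
Proof.
move=> bf bg; rewrite -mulN1r -charge_integralZ// -charge_integralD//.
  by congr (I _); apply/funext => x; rewrite mulN1r.
exact: bmeasZ.
Qed.

(** Moves the domain into the integrand, so that integrals over all sets [A] become values of one
    linear functional. *)
Lemma charge_integral_mkcond A f :
  charge_integral nu A f = I (fun x => \1_A x * f x).
Proof.
rewrite /charge_integral !(Rintegral_mkcond _ A).
have -> // : f \_ A = (fun x => \1_A x * f x).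
by apply/funext => x; rewrite patchE indicE; case: ifP; rewrite ?mul1r ?mul0r.
Qed.

Lemma charge_integral_indic A : measurable A -> I \1_A = fine (nu A).
Proof.
move=> mA; rewrite /charge_integral /Rintegral !integral_indic// setIT.
set PN := svalP _; rewrite (jordan_decomp PN mA) /cadd/= cscaleN1.
rewrite fineB//; last exact: fin_num_measure.
exact: fin_num_measure.
Qed.

(** Continuity for the uniform norm; [K] is the total variation of [nu]. *)
Lemma charge_integral_bound : exists2 K : R, 0 <= K &
  forall f c, bmeas f -> (forall x, `|f x| <= c) -> `|I f| <= K * c.
Proof.
set PN := svalP (hahn_sets nu).
exists (fine (jordan_pos PN setT) + fine (jordan_neg PN setT)).
  by rewrite addr_ge0// fine_ge0.
have bd (mu : {finite_measure set T -> \bar R}) f c :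
    bmeas f -> (forall x, `|f x| <= c) ->
    `|\int[mu]_(x in setT) f x| <= c * fine (mu setT).
  move=> bf fc; apply: le_trans (le_normr_Rintegral _ _) _ => //.
    exact: bmeas_integrable.
  rewrite -Rintegral_cst//; apply: le_Rintegral => //.
    by apply: integrable_norm; exact: bmeas_integrable.
  by apply: bmeas_integrable; exact: bmeas_cst.
move=> f c bf fc; rewrite /charge_integral (le_trans (ler_normB _ _))//.
by rewrite mulrC mulrDr lerD// bd.
Qed.

End ChargeIntegral.

(** Both sides are linear in [f] and continuous for the uniform norm. They agree on indicators by
    hypothesis, hence on step functions and on their uniform limits. Two charges occur because each
    part of a complex density relation mixes the real and imaginary parts of the measure. *)
Lemma charge_density (nu n1 n2 : {charge set T -> \bar R}) (g1 g2 : T -> R) :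
  bmeas g1 -> bmeas g2 ->
  (forall A, measurable A -> fine (nu A) =
     charge_integral n1 A g1 + charge_integral n2 A g2) ->
  forall f, bmeas f -> charge_integral nu setT f =
    charge_integral n1 setT (fun x => f x * g1 x) +
    charge_integral n2 setT (fun x => f x * g2 x).
Proof.
move=> b1 b2 nuE.
(* The defect of the identity, a linear functional to be shown zero. *)
pose J f := charge_integral nu setT f -
  (charge_integral n1 setT (fun x => f x * g1 x) +
   charge_integral n2 setT (fun x => f x * g2 x)).
have hZ (n : {charge set T -> \bar R}) h c f : bmeas h -> bmeas f ->
    charge_integral n setT (fun x => c * f x * h x) =
    c * charge_integral n setT (fun x => f x * h x).
  move=> bh bf; rewrite -charge_integralZ; last exact: bmeasM.
  by congr (charge_integral n _ _); apply/funext => x; rewrite mulrA.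
have hD (n : {charge set T -> \bar R}) h f g : bmeas h -> bmeas f -> bmeas g ->
    charge_integral n setT (fun x => (f x + g x) * h x) =
    charge_integral n setT (fun x => f x * h x) +
    charge_integral n setT (fun x => g x * h x).
  move=> bh bf bg; rewrite -charge_integralD; try exact: bmeasM.
  by congr (charge_integral n _ _); apply/funext => x; rewrite mulrDl.
have JZ c f : bmeas f -> J (fun x => c * f x) = c * J f.
  by move=> bf; rewrite /J charge_integralZ// !hZ//; ring.
have JD f g : bmeas f -> bmeas g -> J (fun x => f x + g x) = J f + J g.
  by move=> bf bg; rewrite /J charge_integralD// !hD//; ring.
have J1 A : measurable A -> J \1_A = 0.
  by move=> mA; rewrite /J charge_integral_indic// nuE//
    -!charge_integral_mkcond subrr.
(* Adding the constant [|M|] makes [f] nonnegative, and [J] vanishes on that constant by the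
   nonnegative case itself. *)
suff J0 f : bmeas f -> (forall x, 0 <= f x) -> J f = 0.
  move=> f bf; apply/eqP; rewrite -subr_eq0 -/(J f).
  have [_ [M fM]] := bf.
  have cE : J (fun=> `|M|) = 0 by apply: J0 => //; exact: bmeas_cst.
  have := JD _ _ bf (bmeas_cst `|M|); rewrite cE addr0 => <-; apply/eqP.
  apply: J0; first by apply: bmeasD => //; exact: bmeas_cst.
  move=> x; have := fM x; rewrite ler_norml => /andP[+ _].
  by have := ler_norm M; lra.
move=> bf f0.
have mS e i : measurable [set t | i.+1%:R * e <= f t].
  have [mf _] := bf.
  by rewrite -[X in measurable X]setTI; apply: measurable_fun_le => //;
    exact: measurable_cst.
have bstep e N : bmeas (step_fun f e N).
  by apply: bmeas_sum => i; apply: bmeasZ; exact: bmeas_indic.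
have Jstep e N : J (step_fun f e N) = 0.
  rewrite /step_fun; elim: N => [|N IH].
    rewrite -[RHS](mul0r (J (fun=> 0))) -JZ; last exact: bmeas_cst.
    by congr J; apply/funext => x; rewrite big_ord0 mul0r.
  rewrite (_ : (fun _ => _) = (fun x => step_fun f e N x +
     e * \1_[set t | N.+1%:R * e <= f t] x)); last first.
    by apply/funext => x; rewrite big_ord_recr.
  rewrite JD ?JZ ?J1 ?mulr0 ?addr0//; try exact: bmeas_indic.
  by apply: bmeasZ; exact: bmeas_indic.
have [K K0 JK] : exists2 K : R, 0 <= K &
    forall h c, bmeas h -> (forall x, `|h x| <= c) -> `|J h| <= K * c.
  have [K0 K00 H0] := charge_integral_bound nu.
  have [K1 K10 H1] := charge_integral_bound n1.
  have [K2 K20 H2] := charge_integral_bound n2.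
  have [_ [M1 gM1]] := b1; have [_ [M2 gM2]] := b2.
  exists (K0 + (K1 * `|M1| + K2 * `|M2|)).
    by rewrite !addr_ge0// mulr_ge0.
  move=> h c bh hc; rewrite /J (le_trans (ler_normB _ _))// mulrDl lerD//.
    exact: H0.
  rewrite (le_trans (ler_normD _ _))// mulrDl -!mulrA lerD//.
    apply: H1; first exact: bmeasM.
    move=> x; rewrite normrM mulrC ler_pM// (le_trans (gM1 x))//; exact: ler_norm.
  apply: H2; first exact: bmeasM.
  by move=> x; rewrite normrM mulrC ler_pM// (le_trans (gM2 x))//; exact: ler_norm.
apply/eqP; rewrite -normr_le0; apply/ler_addgt0Pr => e e0.
(* Dividing by [K + 1] keeps the divisor positive even when [K = 0]. *)
have e'0 : 0 < e / (K + 1) by rewrite divr_gt0// ltr_wpDl.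
have [N fN] := step_fun_approx bf f0 e'0.
rewrite add0r.
have -> : J f = J (fun x => f x - step_fun f (e / (K + 1)) N x).
  have := JD _ _ bf (bmeasZ (-1) (bstep (e / (K + 1)) N)).
  rewrite JZ// Jstep mulr0 addr0 => <-.
  by congr J; apply/funext => x; rewrite mulN1r.
apply: le_trans (JK _ _ _ fN) _; first exact: bmeasB.
by rewrite mulrA ler_pdivrMr ?ltr_wpDl// mulrC ler_pM2l// lerDl.
Qed.

End BoundedMeasurable.

(** * Real and imaginary parts: arithmetic and continuity *)

Section ComplexParts.
Variable R : realType.
Implicit Types x y : R[i].

Lemma Re_addc x y : complex.Re (x + y) = complex.Re x + complex.Re y.
Proof. by case: x y => [? ?] [? ?]. Qed.

Lemma Im_addc x y : complex.Im (x + y) = complex.Im x + complex.Im y.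
Proof. by case: x y => [? ?] [? ?]. Qed.

Lemma Re_mulc x y : complex.Re (x * y) =
  complex.Re x * complex.Re y - complex.Im x * complex.Im y.
Proof. by case: x y => [? ?] [? ?]. Qed.

Lemma Im_mulc x y : complex.Im (x * y) =
  complex.Re x * complex.Im y + complex.Im x * complex.Re y.
Proof. by case: x y => [? ?] [? ?]. Qed.

(** Multiplication by the imaginary unit preserves the modulus and turns [- Im x] into a real
    part. *)
Lemma normc_ge_Im x : (`|complex.Im x|%:C)%C <= `|x|.
Proof.
rewrite -normrN -ReiNIm (le_trans (normc_ge_Re _))//.
by rewrite normrM [X in _ * X]normc_def/= expr0n expr1n add0r sqrtr1 mulr1.
Qed.

Lemma Re_continuous : continuous (@complex.Re R : (R[i])^o -> R).
Proof.
(* Balls of [R[i]] over itself have radii in [R[i]], hence the cast of [e]. *)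
move=> x A /nbhs_ballP[e /= e0 eA]; apply/nbhs_ballP; exists (e%:C)%C => /=.
  by rewrite ltcR.
move=> y xy; apply: eA; move: xy; rewrite /ball/= => xy.
have -> : complex.Re x - complex.Re y = complex.Re (x - y).
  by case: x y {xy} => [? ?] [].
by rewrite -ltcR (le_lt_trans (normc_ge_Re _)).
Qed.

Lemma Im_continuous : continuous (@complex.Im R : (R[i])^o -> R).
Proof.
move=> x A /nbhs_ballP[e /= e0 eA]; apply/nbhs_ballP; exists (e%:C)%C => /=.
  by rewrite ltcR.
move=> y xy; apply: eA; move: xy; rewrite /ball/= => xy.
have -> : complex.Im x - complex.Im y = complex.Im (x - y).
  by case: x y {xy} => [? ?] [].
by rewrite -ltcR (le_lt_trans (normc_ge_Im _)).
Qed.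

End ComplexParts.

(** * Integration against a complex measure and change of density *)

Section ComplexIntegral.
Context d (T : measurableType d) (R : realType).
Implicit Types (f g : T -> R[i]) (c : R[i]) (mu nu : complex_measure T R).

Definition cbmeas f :=
  bmeas (fun x => complex.Re (f x)) /\ bmeas (fun x => complex.Im (f x)).

Lemma cbmeas_cst c : cbmeas (fun=> c).
Proof. by split; exact: bmeas_cst. Qed.

Lemma cbmeasD f g : cbmeas f -> cbmeas g -> cbmeas (fun x => f x + g x).
Proof.
move=> [? ?] [? ?]; split.
  by under eq_fun do rewrite Re_addc; exact: bmeasD.
by under eq_fun do rewrite Im_addc; exact: bmeasD.
Qed.

Lemma cbmeasM f g : cbmeas f -> cbmeas g -> cbmeas (fun x => f x * g x).
Proof.
move=> [? ?] [? ?]; split.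
  by under eq_fun do rewrite Re_mulc; apply: bmeasB; exact: bmeasM.
by under eq_fun do rewrite Im_mulc; apply: bmeasD; exact: bmeasM.
Qed.

Lemma cbmeas_prod (I : Type) (r : seq I) (F : I -> T -> R[i]) :
  (forall i, cbmeas (F i)) -> cbmeas (fun x => \prod_(i <- r) F i x).
Proof.
move=> bF; elim: r => [|i r IH].
  by under eq_fun do rewrite big_nil; exact: cbmeas_cst.
by under eq_fun do rewrite big_cons; exact: cbmeasM.
Qed.

Lemma cbmeas_sum (I : Type) (r : seq I) (F : I -> T -> R[i]) :
  (forall i, cbmeas (F i)) -> cbmeas (fun x => \sum_(i <- r) F i x).
Proof.
move=> bF; elim: r => [|i r IH].
  by under eq_fun do rewrite big_nil; exact: cbmeas_cst.
by under eq_fun do rewrite big_cons; exact: cbmeasD.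
Qed.

Lemma cbmeasX f n : cbmeas f -> cbmeas (fun x => f x ^+ n).
Proof.
move=> bf; elim: n => [|n IH].
  by under eq_fun do rewrite expr0; exact: cbmeas_cst.
by under eq_fun do rewrite exprS; exact: cbmeasM.
Qed.

Lemma cbmeas_conj f : cbmeas f -> cbmeas (fun x => (f x)^*).
Proof.
move=> [bu bv]; split.
  by rewrite (_ : (fun _ => _) = (fun x => complex.Re (f x)))//;
    apply/funext => x; case: (f x).
rewrite (_ : (fun _ => _) = (fun x => -1 * complex.Im (f x))); first exact: bmeasZ.
by apply/funext => x; case: (f x) => a b; rewrite mulN1r.
Qed.

Section Linearity.
Variable mu : complex_measure T R.
Local Notation I := (cintegral mu setT).

Lemma cintegralD f g : cbmeas f -> cbmeas g ->
  I (fun x => f x + g x) = I f + I g.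
Proof.
move=> [? ?] [? ?]; rewrite /cintegral.
have -> : (fun x => complex.Re (f x + g x)) =
    (fun x => complex.Re (f x) + complex.Re (g x)).
  by apply/funext => x; rewrite Re_addc.
have -> : (fun x => complex.Im (f x + g x)) =
    (fun x => complex.Im (f x) + complex.Im (g x)).
  by apply/funext => x; rewrite Im_addc.
rewrite !charge_integralD//.
by apply/eqP; rewrite eq_complex/=; apply/andP; split; apply/eqP; ring.
Qed.

Lemma cintegralZ c f : cbmeas f -> I (fun x => c * f x) = c * I f.
Proof.
move=> [bu bv]; rewrite /cintegral.
have -> : (fun x => complex.Re (c * f x)) =
    (fun x => complex.Re c * complex.Re (f x) - complex.Im c * complex.Im (f x)).
  by apply/funext => x; rewrite Re_mulc.
have -> : (fun x => complex.Im (c * f x)) =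
    (fun x => complex.Re c * complex.Im (f x) + complex.Im c * complex.Re (f x)).
  by apply/funext => x; rewrite Im_mulc.
rewrite !charge_integralB ?charge_integralD; try exact: bmeasZ.
rewrite !charge_integralZ//; case: c => a b.
by apply/eqP; rewrite eq_complex/=; apply/andP; split; apply/eqP; ring.
Qed.

Lemma cintegral_sum (J : Type) (r : seq J) (F : J -> T -> R[i]) :
  (forall j, cbmeas (F j)) ->
  I (fun x => \sum_(j <- r) F j x) = \sum_(j <- r) I (F j).
Proof.
move=> bF; elim: r => [|j r IH].
  rewrite big_nil -[RHS](mul0r (I (fun=> 0))) -cintegralZ; last exact: cbmeas_cst.
  by congr (I _); apply/funext => x; rewrite big_nil mul0r.
rewrite big_cons -IH -cintegralD//; last exact: cbmeas_sum.
by congr (I _); apply/funext => x; rewrite big_cons.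
Qed.

End Linearity.

(** The real and imaginary parts of the density relation are two instances of [charge_density],
    recombined by complex multiplication. *)
Lemma has_density_cintegral nu g mu f : cbmeas g -> has_density nu g mu ->
  cbmeas f -> cintegral nu setT f = cintegral mu setT (fun x => f x * g x).
Proof.
move=> [ga gb] dnu [fu fv].
(* The minus sign is absorbed into the density [-1 * Im g], since [charge_density] adds its two
   terms. *)
have nuE A : measurable A ->
    fine (cmeas_Re nu A) =
      charge_integral (cmeas_Re mu) A (fun x => complex.Re (g x)) +
      charge_integral (cmeas_Im mu) A (fun x => -1 * complex.Im (g x)) /\
    fine (cmeas_Im nu A) =
      charge_integral (cmeas_Im mu) A (fun x => complex.Re (g x)) +
      charge_integral (cmeas_Re mu) A (fun x => complex.Im (g x)).
  move=> mA; have [-> ->] := dnu A mA; split=> //; congr (_ + _).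
  rewrite !(charge_integral_mkcond _ A) -[LHS]mulN1r -charge_integralZ.
    by congr (charge_integral _ _ _); apply/funext => x; rewrite mulrCA.
  by apply: bmeasM => //; exact: bmeas_indic.
have dR := charge_density ga (bmeasZ (-1) gb) (fun A mA => (nuE A mA).1).
have dI := charge_density ga gb (fun A mA => (nuE A mA).2).
have NZ n u : bmeas u ->
    charge_integral n setT (fun x => u x * (-1 * complex.Im (g x))) =
    - charge_integral n setT (fun x => u x * complex.Im (g x)).
  move=> bu; rewrite -[RHS]mulN1r -charge_integralZ//; last exact: bmeasM.
  by congr (charge_integral _ _ _); apply/funext => x; rewrite mulrCA.
rewrite /cintegral.
have -> : (fun x => complex.Re (f x * g x)) = (fun x =>
    complex.Re (f x) * complex.Re (g x) - complex.Im (f x) * complex.Im (g x)).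
  by apply/funext => x; rewrite Re_mulc.
have -> : (fun x => complex.Im (f x * g x)) = (fun x =>
    complex.Re (f x) * complex.Im (g x) + complex.Im (f x) * complex.Re (g x)).
  by apply/funext => x; rewrite Im_mulc.
rewrite !charge_integralB ?charge_integralD; try exact: bmeasM.
rewrite !dR// !dI// !NZ//.
by apply/eqP; rewrite eq_complex/=; apply/andP; split; apply/eqP; ring.
Qed.

End ComplexIntegral.

(** * Monomials on the torus and their moments *)

Section TorusMonomials.
Variables (R : realType) (D : nat).
Implicit Types (al be : mindex D) (t : borel_torus R D).

Lemma open_borel_torus (U : set (torus R D)) :
  open U -> measurable (U : set (borel_torus R D)).
Proof. exact: sub_sigma_algebra. Qed.

Lemma continuous_bmeas (f : torus R D -> R) : continuous f ->
  measurable_fun setT (f : borel_torus R D -> R).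
Proof.
move=> /continuousP cf; apply: (measurability _ (RGenOpens.measurableE R)).
move=> _ [_ [a [b ->] <-]]; rewrite setTI.
by apply: open_borel_torus; apply: cf; exact: interval_open.
Qed.

Lemma torus_pt_norm t a : `|torus_pt t 0 a| = 1.
Proof. by case: t => z zT; move/set_mem: (zT) => /(_ a). Qed.

Lemma torus_cstar t : cstar (torus_pt t).
Proof. by move=> a; rewrite -normr_eq0 torus_pt_norm oner_eq0. Qed.

Lemma torus_coord_continuous (a : 'I_D) :
  continuous ((fun t => torus_pt t 0 a) : torus R D -> (R[i])^o).
Proof.
move=> t; apply: (@continuous_comp _ _ _ (fun t : torus R D => \val t)
    (fun z : 'rV[(R[i])^o]_D => z 0 a)); last exact: coord_continuous.
exact: initial_continuous.
Qed.

Lemma cbmeas_torus_coord (a : 'I_D) : cbmeas (fun t => torus_pt t 0 a).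
Proof.
split; split.
- apply: continuous_bmeas => t.
  apply: (continuous_comp (@torus_coord_continuous a t)).
  exact: Re_continuous.
- exists 1 => t; rewrite -lecR (le_trans (normc_ge_Re _))//.
  by rewrite torus_pt_norm.
- apply: continuous_bmeas => t.
  apply: (continuous_comp (@torus_coord_continuous a t)).
  exact: Im_continuous.
- exists 1 => t; rewrite -lecR (le_trans (normc_ge_Im _))//.
  by rewrite torus_pt_norm.
Qed.

Lemma torus_pt_inv t a : (torus_pt t 0 a)^-1 = (torus_pt t 0 a)^*.
Proof. by rewrite invC_norm torus_pt_norm expr1n invr1 mul1r. Qed.

Lemma cbmeas_mono al : cbmeas (fun t => mono al (torus_pt t)).
Proof.
apply: cbmeas_prod => a; case: (al a) => n.
  exact/cbmeasX/cbmeas_torus_coord.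
(* A negative power is a positive power of the conjugate, because coordinates have modulus 1. *)
rewrite (_ : (fun _ => _) = (fun t : borel_torus R D =>
  ((torus_pt t 0 a)^*) ^+ n.+1)); first exact/cbmeasX/cbmeas_conj/cbmeas_torus_coord.
by apply/funext => t; rewrite NegzE -exprnN -exprVn torus_pt_inv.
Qed.

Lemma monoD (z : 'rV[R[i]]_D) al be : cstar z ->
  mono (al + be) z = mono al z * mono be z.
Proof.
move=> zC; rewrite /mono -big_split/=; apply: eq_bigr => a _.
by rewrite ffunE expfzDr.
Qed.

Lemma mono_conj t al : (mono al (torus_pt t))^* = mono (- al) (torus_pt t).
Proof.
rewrite /mono rmorph_prod/=; apply: eq_bigr => a _.
by rewrite ffunE -exprz_inv torus_pt_inv; apply: rmorphXz; rewrite unitfE torus_cstar.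
Qed.

Definition moment (mu : complex_measure (borel_torus R D) R) al : R[i] :=
  cintegral mu setT (fun t => mono al (torus_pt t)).

(** The Toeplitz structure of the moment matrix: on the torus, conjugating a monomial negates its
    exponent. *)
Lemma moment_matrixE mu : moment_matrix mu = simx_of (fun al be => moment mu (al - be)).
Proof.
rewrite /moment_matrix /moment; congr simx_of.
apply/funext => al; apply/funext => be; congr (cintegral _ _ _).
by apply/funext => t; rewrite mono_conj monoD//; exact: torus_cstar.
Qed.

Lemma moment_density mu nu (L : laurent R D) al :
  has_density nu (fun t => leval L (torus_pt t)) mu ->
  moment nu al = \sum_(ga <- finsupp L) L ga * moment mu (ga + al).
Proof.
move=> dnu.
have bL ga : cbmeas (fun t : borel_torus R D => L ga * mono ga (torus_pt t)).
  by apply: cbmeasM; [exact: cbmeas_cst|exact: cbmeas_mono].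
rewrite /moment (has_density_cintegral _ dnu); first last.
- exact: cbmeas_mono.
- exact: cbmeas_sum.
rewrite [RHS](eq_bigr (fun ga => cintegral mu setT
    (fun t => L ga * mono (ga + al) (torus_pt t)))); last first.
  by move=> ga _; rewrite cintegralZ//; exact: cbmeas_mono.
rewrite -cintegral_sum; last first.
  by move=> ga; apply: cbmeasM; [exact: cbmeas_cst|exact: cbmeas_mono].
congr (cintegral _ _ _); apply/funext => t; rewrite /leval mulr_sumr.
by apply: eq_bigr => ga _; rewrite monoD; [rewrite mulrC mulrA|exact: torus_cstar].
Qed.

End TorusMonomials.

(** * Levels of multi-indices and the action of [L(Upsilon)] *)

Section Levels.
Variables (R : realType) (D : nat).
Local Notation C := R[i].
Implicit Types (L : laurent R D) (al be ga : mindex D) (f : mindex D -> C).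

Lemma mlen_midx k (i : 'I_(lsize D k)) : mlen (midx i) = k.
Proof. by apply/eqP; rewrite -mem_level mem_nth. Qed.

Lemma midx_inj k : injective (@midx D k).
Proof.
move=> i j /eqP; rewrite nth_uniq ?level_uniq ?ltn_ord// => /eqP.
exact: val_inj.
Qed.

Lemma mlenD al be : (mlen (al + be)%R <= mlen al + mlen be)%N.
Proof.
have absD (x y : int) : (`|(x + y)%R| <= `|x| + `|y|)%N by lia.
by rewrite -big_split/=; apply: leq_sum => a _; rewrite ffunE; exact: absD.
Qed.

Lemma mlen_longitude L ga : ga \in finsupp L -> (mlen ga <= longitude L)%N.
Proof. by move=> gaL; exact: leq_bigmax_seq. Qed.

(** Substitute [al = ga + be]; only [ga] in the support of [L] contribute. *)
Lemma sum_level_shift L f be j :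
  \sum_(al <- level D j) L (al - be) * f al =
  \sum_(ga <- finsupp L | mlen (ga + be) == j) L ga * f (ga + be).
Proof.
rewrite (bigID (fun al => al - be \in finsupp L))/= [X in _ + X]big1 ?addr0; last first.
  by move=> al /fsfun_dflt ->; rewrite mul0r.
rewrite -big_filter -[RHS]big_filter.
have -> s : \sum_(ga <- s) L ga * f (ga + be) =
    \sum_(al <- [seq ga + be | ga <- s]) L (al - be) * f al.
  by rewrite big_map; apply: eq_bigr => ga _; rewrite addrK.
apply/perm_big/uniq_perm.
- exact/filter_uniq/level_uniq.
- by rewrite map_inj_uniq ?filter_uniq ?fset_uniq//; exact: addIr.
move=> al; rewrite mem_filter mem_level; apply/andP/mapP => [[alL /eqP alj]|].
  by exists (al - be); rewrite ?mem_filter subrK// alj eqxx.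
by move=> [ga]; rewrite mem_filter => /andP[gaj gaL] ->; rewrite addrK.
Qed.

(** Each [ga + be] with [ga] in the support of [L] lies in exactly one level, and by the triangle
    inequality that level is at most [M]. *)
Lemma sum_levels_shift L f be M : (mlen be + longitude L <= M)%N ->
  \sum_(j < M.+1) \sum_(c < lsize D j) L (midx c - be) * f (midx c) =
  \sum_(ga <- finsupp L) L ga * f (ga + be).
Proof.
move=> beM.
under eq_bigr => j _.
  rewrite (_ : (\sum_(c < _) _) = \sum_(al <- level D j) L (al - be) * f al);
    last by rewrite [RHS](big_nth 0) big_mkord.
  rewrite sum_level_shift big_mkcond/=.
over.
rewrite exchange_big/= !big_seq; apply: eq_bigr => ga gaL.
have lt_M : (mlen (ga + be)%R < M.+1)%N.
  by rewrite ltnS (leq_trans (mlenD _ _))// addnC (leq_trans _ beM)// leq_add2l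
    mlen_longitude.
by rewrite -big_mkcond (big_pred1 (Ordinal lt_M)).
Qed.

(** Common source of [upsilon_chi] and [upsilon_moment]: [f d] is column [d] of the right factor,
    and any cut-off [M] past the band gives the whole product. *)
Lemma upsilon_mul L q (f : 'I_q -> mindex D -> C) i M : (i + longitude L <= M)%N ->
  \sum_(j < M.+1) upsilon L i j *m
     (\matrix_(c, d) f d (midx c) : 'M[C]_(lsize D j, q)) =
  \matrix_(b, d) \sum_(ga <- finsupp L) L ga * f d (ga + midx b).
Proof.
move=> iM; apply/matrixP => b d; rewrite summxE mxE.
rewrite -(@sum_levels_shift _ (f d) _ M) ?mlen_midx//.
by apply: eq_bigr => j _; rewrite mxE; apply: eq_bigr => c _; rewrite !mxE.
Qed.

Lemma upsilon_band L i j : (i + longitude L < j)%N -> upsilon L i j = 0.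
Proof.
move=> ij; apply/matrixP => b c; rewrite !mxE; apply: fsfun_dflt.
apply/negP => /mlen_longitude; apply/negP; rewrite -ltnNge.
have := mlenD (midx c - midx b) (midx b).
by rewrite subrK !mlen_midx; move: ij; lia.
Qed.

(** The column [chi] is an eigenvector of [L(Upsilon)] with eigenvalue [L(z)]. *)
Lemma upsilon_chi L (z : 'rV[C]_D) i M : cstar z -> (i + longitude L <= M)%N ->
  \sum_(j < M.+1) upsilon L i j *m chi j z = leval L z *: chi i z.
Proof.
move=> zC iM; rewrite (upsilon_mul (fun _ al => mono al z) iM).
apply/matrixP => b d; rewrite !mxE mulr_suml.
by apply: eq_bigr => ga _; rewrite monoD// mulrA.
Qed.

(** Multiplying the measure by [L] multiplies its moment matrix by [L(Upsilon)] on the left. *)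
Lemma upsilon_moment mu nu L i l M : (i + longitude L <= M)%N ->
  has_density nu (fun t => leval L (torus_pt t)) mu ->
  \sum_(j < M.+1) upsilon L i j *m @moment_matrix R D mu j l =
  moment_matrix nu i l.
Proof.
move=> iM dnu; rewrite !moment_matrixE.
rewrite (upsilon_mul (fun d al => moment mu (al - midx d)) iM).
apply/matrixP => b d; rewrite !mxE (moment_density _ dnu).
by apply: eq_bigr => ga _; rewrite addrA.
Qed.

End Levels.

(** * Block triangular matrices and the Gauss-Borel factorization *)

Section BlockTriangular.
Variables (R : realType) (D : nat).
Local Notation C := R[i].
Local Notation n := (lsize D).
Implicit Types (A B X : simx R D).

Definition lower_tri A := forall k l, (k < l)%N -> A k l = 0.

(** Gives all rows a common summation bound, so that sums can be exchanged. *)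
Lemma lower_sum A q (X : forall j, 'M[C]_(n j, q)) k M : lower_tri A -> (k <= M)%N ->
  \sum_(j < k.+1) A k j *m X j = \sum_(j < M.+1) A k j *m X j.
Proof.
move=> lA kM; rewrite (big_ord_widen M.+1 (fun j => A k j *m X j)) ?ltnS//.
rewrite big_mkcond; apply: eq_bigr => j _.
by case: ltnP => // kj; rewrite lA// mul0mx.
Qed.

(** Associativity [(A B) X = A (B X)]; the free width [q] covers both columns of matrices and
    vectors such as [chi]. *)
Lemma simul_sum A B q (X : forall j, 'M[C]_(n j, q)) k : lower_tri B ->
  \sum_(j < k.+1) simul A B k j *m X j =
  \sum_(i < k.+1) A k i *m \sum_(j < i.+1) B i j *m X j.
Proof.
move=> lB; under eq_bigr do rewrite mulmx_suml.
rewrite exchange_big/=; apply: eq_bigr => i _.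
rewrite (lower_sum X lB (ltnSE (ltn_ord i))) mulmx_sumr.
by apply: eq_bigr => j _; rewrite mulmxA.
Qed.

Lemma sione_diag k : sione R D k k = 1%:M.
Proof. by apply/matrixP => i j; rewrite !mxE (inj_eq (@midx_inj D k)). Qed.

Lemma sione_offdiag k l : k != l -> sione R D k l = 0.
Proof.
move=> kl; apply/matrixP => i j; rewrite !mxE; case: eqP => // ij.
by move: kl; rewrite -(mlen_midx i) -(mlen_midx j) ij eqxx.
Qed.

Lemma sione_sum q (X : forall j, 'M[C]_(n j, q)) k :
  \sum_(j < k.+1) sione R D k j *m X j = X k.
Proof.
rewrite big_ord_recr/= sione_diag mul1mx big1 ?add0r// => j _.
by rewrite sione_offdiag ?mul0mx// gtn_eqF.
Qed.

(** The adjoint of a lower triangular matrix is upper triangular, and a block diagonal left factor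
    keeps it so. *)
Lemma gauss_borel_upper (G S H Sh : simx R D) : gauss_borel G S H Sh ->
  exists Si X : simx R D,
  [/\ lower_inverse S Si,
      forall k l, G k l = simul Si X k l &
      forall k l, (l < k)%N -> X k l = 0].
Proof.
move=> [uS uSh dH [Si [Shi [iS [[lShi _] _ _] GE]]]].
exists Si, (simul H (sidagger Shi)).
have XE k l : simul H (sidagger Shi) k l = H k k *m sidagger Shi k l.
  rewrite /simul big_ord_recr/= big1 ?add0r// => j _.
  by rewrite dH ?mul0mx// gtn_eqF.
by split=> // k l lk; rewrite XE /sidagger lShi// trmx0 raddf0 mulmx0.
Qed.

(** [S G = S (S^-1 X) = X] by associativity. *)
Lemma lower_inverse_mul (S Si X G : simx R D) k l : lower_tri S ->
  lower_inverse S Si -> (forall k l, G k l = simul Si X k l) ->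
  \sum_(j < k.+1) S k j *m G j l = X k l.
Proof.
move=> lS [[lSi _] SSi _] GE.
rewrite -(sione_sum (fun j => X j l)); under [RHS]eq_bigr do rewrite -SSi.
by rewrite (simul_sum _ (fun j => X j l))//; apply: eq_bigr => j _; rewrite GE.
Qed.

(** The row [u = v S_k] satisfies [u G = v X_k] on the blocks [0..k]. These vanish, by triangularity
    before [k] and by assumption at [k], so [u = 0]; its last block is [v] because [S k k = 1]. *)
Lemma upper_diag_regular (S Si X G : simx R D) k q (v : 'M[C]_(q, n k)) :
  lower_unitri S -> lower_inverse S Si ->
  (forall k l, G k l = simul Si X k l) -> (forall k l, (l < k)%N -> X k l = 0) ->
  \det (trunc G k.+1) != 0 -> v *m X k k = 0 -> v = 0.
Proof.
move=> [lS dS] iS GE uX detG vX.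
have sub0 (j : 'I_k.+1) :
    submxrow (0 : 'M[C]_(q, \sum_(i < k.+1) n i)) j = 0.
  by apply/matrixP => a b; rewrite !mxE.
pose u := \mxrow_(j < k.+1) (v *m S k j).
have uG : u *m trunc G k.+1 = 0.
  rewrite mul_mxrow_mxblock -[RHS](submxrowK); apply/eq_mxrowP => j.
  rewrite sub0; under eq_bigr do rewrite -mulmxA.
  rewrite -mulmx_sumr (lower_inverse_mul _ _ lS iS GE).
  have := ltn_ord j; rewrite ltnS leq_eqVlt => /predU1P[->//|jk].
  by rewrite uX// mulmx0.
have u0 : u = 0.
  by rewrite -[LHS](@mulmxK _ _ _ (trunc G k.+1)) ?uG ?mul0mx// unitmxE unitfE.
have := mxrowK (fun j : 'I_k.+1 => v *m S k j) ord_max.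
by rewrite -/u u0 sub0 /= dS mulmx1.
Qed.

End BlockTriangular.

(** * Connection coefficients between the two families *)

Section Connection.
Variables (R : realType) (D : nat).
Local Notation C := R[i].
Local Notation n := (lsize D).
Variables (mu Tmu : complex_measure (borel_torus R D) R) (L : laurent R D).
Variables (S H Sh TS TH TSh : simx R D) (k : nat).
Hypotheses (dT : has_density Tmu (fun t => leval L (torus_pt t)) mu)
  (qmu : quasi_definite mu)
  (hS : gauss_borel (moment_matrix mu) S H Sh)
  (hTS : gauss_borel (moment_matrix Tmu) TS TH TSh).
Local Notation m := (longitude L).
Local Notation N := (k + m)%N.

(* Row [k] of the resolvent [TS L(Upsilon) S^-1]; the columns past [k + m]
   vanish. *)
Lemma connection_coefficients : exists r : forall j, 'M[C]_(n k, n j),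
  [/\ forall j, (j < k)%N -> r j = 0,
      r N = upsilon L k N &
      forall z : 'rV[C]_D, cstar z ->
        \sum_(j < N.+1) r j *m phi S j z = leval L z *: phi TS k z].
Proof.
have [uS _ _ _] := hS; have [lS _] := uS.
have [[lTS dTS] _ _ _] := hTS.
have [Si [X [iS GE uX]]] := gauss_borel_upper hS.
have [TSi [TX [iTS TGE uTX]]] := gauss_borel_upper hTS.
have [[lSi dSi] _ SiS] := iS.
(* Row [k] of [TS L(Upsilon)]. It vanishes past block [N], so cutting the product with [Si] at [N]
   loses nothing. *)
pose Q i := \sum_(a < k.+1) TS k a *m upsilon L a i.
pose r j := \sum_(i < N.+1) Q i *m Si i j.
have QE q (Y : forall j, 'M[C]_(n j, q)) : \sum_(i < N.+1) Q i *m Y i =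
    \sum_(a < k.+1) TS k a *m \sum_(i < N.+1) upsilon L a i *m Y i.
  under eq_bigr do rewrite mulmx_suml.
  rewrite exchange_big/=; apply: eq_bigr => a _.
  by rewrite mulmx_sumr; apply: eq_bigr => i _; rewrite mulmxA.
have rE q (Y : forall j, 'M[C]_(n j, q)) : \sum_(j < N.+1) r j *m Y j =
    \sum_(i < N.+1) Q i *m \sum_(j < i.+1) Si i j *m Y j.
  under eq_bigr do rewrite mulmx_suml.
  rewrite exchange_big/=; apply: eq_bigr => i _.
  rewrite (lower_sum Y lSi (ltnSE (ltn_ord i))) mulmx_sumr.
  by apply: eq_bigr => j _; rewrite mulmxA.
have aN (a : 'I_k.+1) : (a + m <= N)%N by rewrite leq_add2r -ltnS.
(* [TS L(Upsilon) S^-1 X = TS L(Upsilon) G = TS TG = TX]. *)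
have rX l : \sum_(j < N.+1) r j *m X j l = TX k l.
  rewrite (rE _ (fun j => X j l)) -(lower_inverse_mul k l lTS iTS TGE).
  under eq_bigr => i _ do rewrite -[\sum_(j < _) _]GE.
  rewrite (QE _ (fun i => moment_matrix mu i l)).
  by apply: eq_bigr => a _; rewrite (upsilon_moment _ (aN a) dT).
exists r; split=> [l||z zC].
(* Column [l] of [rX] reduces to [r l *m X l l = 0]: terms with [j < l] vanish by induction, those
   with [j > l] because [X] is upper triangular. *)
- elim/ltn_ind: l => l IH lk.
  have lN : (l < N.+1)%N by rewrite ltnS (leq_trans (ltnW lk))// leq_addr.
  apply: (upper_diag_regular uS iS GE uX (qmu (ltn0Sn l))).
  have := rX l; rewrite uTX// (bigD1 (Ordinal lN))//= big1 ?addr0// => j jl.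
  have [jlt|lj] := ltnP j l; first by rewrite IH ?mul0mx// (ltn_trans jlt).
  by rewrite uX ?mulmx0// ltn_neqAle lj andbT eq_sym; exact: jl.
(* Column [N] meets [Si] only at its unit diagonal block, and the band of [L(Upsilon)] leaves only
   [a = k]. *)
- rewrite /r big_ord_recr/= big1 ?add0r ?dSi ?mulmx1; last first.
    by move=> i _; rewrite lSi ?mulmx0.
  rewrite /Q big_ord_recr/= big1 ?add0r ?dTS ?mul1mx// => a _.
  by rewrite upsilon_band ?mulmx0// ltn_add2r.
(* [S^-1 Phi = chi], on which [L(Upsilon)] acts as the scalar [L(z)]. *)
- rewrite (rE _ (fun j => phi S j z)).
  have phiE i : \sum_(j < i.+1) Si i j *m phi S j z = chi i z.
    rewrite -(simul_sum Si (fun b => chi b z) i lS).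
    under eq_bigr do rewrite SiS.
    exact: (sione_sum (fun b => chi b z)).
  under eq_bigr do rewrite phiE.
  rewrite (QE _ (fun i => chi i z)) /phi scaler_sumr.
  by apply: eq_bigr => a _; rewrite (upsilon_chi zC (aN a)) scalemxAr.
Qed.

End Connection.

Theorem theorem3p1 (R : realType) (D : nat) (hD : (1 <= D)%N)
    (mu Tmu : complex_measure (borel_torus R D) R)
    (L : laurent R D) (m : nat) (hm : m = longitude L)
    (hT : has_density Tmu (fun t => leval L (torus_pt t)) mu)
    (qmu : quasi_definite mu) (qTmu : quasi_definite Tmu)
    (S H Sh TS TH TSh : simx R D)
    (hS : gauss_borel (moment_matrix mu) S H Sh)
    (hTS : gauss_borel (moment_matrix Tmu) TS TH TSh)
    (k : nat) (p : 'I_(nnodes D k m) -> 'rV[R[i]]_D)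
    (hp : poised L S p)
    (z : 'rV[R[i]]_D) (hz : cstar z) (hLz : leval L z != 0) :
  phi TS k z =
    (leval L z)^-1 *: (upsilon L k (k + m)%N *m
       last_quasidet (sample_mx S p) (phi_stack S k m z)
                     (sample_row S p) (phi S (k + m) z)).
Proof.
have [r [r0 rN rphi]] := connection_coefficients k hT qmu hS hTS.
rewrite -hm in rN rphi; have [pZ detS] := hp.
(* The unknown coefficients; the remaining one, [r (k + m)], is the block of [L(Upsilon)]. *)
pose W := \mxrow_(i < m) r (k + i)%N.
have WE w : cstar w -> W *m phi_stack S k m w =
    leval L w *: phi TS k w - upsilon L k (k + m)%N *m phi S (k + m) w.
  move=> wC; rewrite -rphi// big_ord_recr/= rN addrK mul_mxrow_mxcol.
  by rewrite big_split_ord/= [X in _ = X + _]big1 ?add0r// => i _; rewrite r0 ?mul0mx.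
(* Exposes the entries of a product while those of its factors stay folded. *)
have mulmx_entry q s t (A : 'M[R[i]]_(q, s)) (B : 'M[R[i]]_(s, t)) b c :
    (A *m B) b c = \sum_a A b a * B a c by exact: mxE.
(* Column [j] is [WE] at the node [p j], where [L] vanishes. *)
have WS : W *m sample_mx S p = - (upsilon L k (k + m)%N *m sample_row S p).
  apply/matrixP => b j; have [pC L0] := pZ j.
  transitivity ((W *m phi_stack S k m (p j)) b 0).
    by rewrite !mulmx_entry; apply: eq_bigr => c _; congr (_ * _); exact: mxE.
  rewrite (WE _ pC) L0 scale0r sub0r [LHS]mxE [RHS]mxE !mulmx_entry; congr (- _).
  by apply: eq_bigr => c _; congr (_ * _); rewrite [RHS]mxE.
apply: (scalerI hLz); rewrite scalerA divff// scale1r.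
(* Poisedness makes [sample_mx] invertible, so the correction term of the quasi-determinant becomes
   [W *m phi_stack], which [WE] evaluates at [z]. *)
rewrite /last_quasidet mulmxBr !mulmxA -[_ *m sample_row _ _]opprK -WS.
rewrite !mulNmx mulmxK ?unitmxE ?unitfE// WE// opprK.
by rewrite addrC subrK.
Qed.
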